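(* Let $A$ be a connected graded locally finite algebra over a field $k$, and let $E$ be the $A_\infty$-algebra $\mathrm{Ext}^*_A(k_A,k_A)$. Let $Q=\mathfrak{m}/\mathfrak{m}^2$ be the graded vector space of generators of $A$. Let $R=\bigoplus_{s\ge 2}R_s$ be a minimal graded space of relations of $A$, with $R_s$ chosen so that $R_s\subset \bigoplus_{1\le i\le s-1}Q_i\otimes A_{s-i}\subset \bigl(\bigoplus_{m\ge 2}Q^{\otimes m}\bigr)_s$. For each $n\ge 2$ and $s\ge 2$, let $i_s:R_s\to \bigl(\bigoplus_{m\ge 2}Q^{\otimes m}\bigr)_s$ be the inclusion map and let $i_s^n$ be the composite $$R_s\xrightarrow{\ i_s\ }\Bigl(\bigoplus_{m\ge 2}Q^{\otimes m}\Bigr)_s\longrightarrow (Q^{\otimes n})_s$$ of $i_s$ with the projection onto the tensor length $n$ summand. Then in any Adams degree $-s$, the multiplication $m_n$ of $E$ restricted to $\bigl((E^1)^{\otimes n}\bigr)_{-s}$ is equal to the $k$-linear dual $$(i_s^n)^{\#}:\bigl((E^1)^{\otimes n}\bigr)_{-s}=\bigl((Q^{\otimes n})_s\bigr)^{\#}\longrightarrow R_s^{\#}\subset E^2_{-s}.$$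
   Context: All algebras and vector spaces are over a field $k$. A connected graded algebra is $A=k\oplus A_1\oplus A_2\oplus\cdots$ (associative, unital); $\mathfrak m=\bigoplus_{i\ge1}A_i$; locally finite means every $A_i$ is finite-dimensional. $k_A$ is the trivial right module $A/\mathfrak m$. The grading induced from $A$ is the Adams grading, written as a subscript; the (co)homological grading is a superscript. $V^{\#}$ is the graded $k$-linear dual. $(Q^{\otimes n})_s=\bigoplus_{i_1+\dots+i_n=s}Q_{i_1}\otimes\dots\otimes Q_{i_n}$, all $i_j\geq 1$. **Generators and relations.** Put $D_1=0$, $Q_1=A_1$, and for $s\ge2$ let $D_s$ be the image of the multiplication $\bigoplus_{1\le i\le s-1}Q_i\otimes A_{s-i}\to A_s$ and $Q_s$ a chosen vector space complement of $D_s$ in $A_s$; then $Q=\bigoplus_s Q_s\cong\mathfrak m/\mathfrak m^2$. Choose linear maps $\xi_s:D_s\to\bigoplus_{1\le i\le s-1}Q_i\otimes A_{s-i}$ splitting multiplication. Define recursively embeddings $\theta_s:A_s\to\bigl(\bigoplus_{m\ge1}Q^{\otimes m}\bigr)_s$ splitting the multiplication map: $\theta_s$ is the inclusion on $Q_s$ and is $\bigl(\sum_i \mathrm{id}_{Q_i}\otimes\theta_{s-i}\bigr)\circ\xi_s$ on $D_s$. Through these embeddings $\bigoplus_{1\le i\le s-1}Q_i\otimes A_{s-i}$ is viewed as a subspace of $\bigl(\bigoplus_{m\ge2}Q^{\otimes m}\bigr)_s$. A minimal graded space of relations is a minimal graded subspace $R$ of the tensor algebra $T\langle Q\rangle$ generating,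 as a two-sided ideal, the kernel of $T\langle Q\rangle\to A$. There are natural isomorphisms $\mathrm{Ext}^1_A(k_A,k_A)\cong Q^{\#}$ and $\mathrm{Ext}^2_A(k_A,k_A)\cong R^{\#}$ of graded spaces, so $E^1_{-s}\cong Q_s^{\#}$, $E^2_{-s}\cong R_s^{\#}$. **$A_\infty$-algebras.** An $A_\infty$-algebra is a $\mathbb Z$-graded vector space $A=\bigoplus_p A^p$ with graded maps $m_n:A^{\otimes n}\to A$ $(n\ge1)$ of degree $2-n$ such that for all $n\geq 1$, $\sum(-1)^{r+st}m_u(\mathrm{id}^{\otimes r}\otimes m_s\otimes\mathrm{id}^{\otimes t})=0$, summed over $n=r+s+t$, $r,t\ge0$, $s\ge1$, with $u=r+1+t$ (Koszul signs when applied to elements). If there is an Adams grading, all $m_n$ preserve it. **Merkulov's construction.** For a DG algebra $(T,\partial)$ let $B^n$, $Z^n$ be the coboundaries and cocycles, and choose subspaces (compatible with Adams grading) with $Z^n=B^n\oplus H^n$, $T^n=B^n\oplus H^n\oplus L^n$. Identify the cohomology $HT$ with $\bigoplus H^n$, let $p$ be the projection onto it, and let $G^n:T^n\to T^{n-1}$ be zero on $H^n\oplus L^n$ and $(\partial^{n-1}|_{L^{n-1}})^{-1}$ on $B^n$. Set formally $G\lambda_1=-\mathrm{id}$, let $\lambda_2$ be multiplication, and $\lambda_n=\sum_{s+t=n,\,s,t\ge1}(-1)^{s+1}\lambda_2(G\lambda_s\otimes G\lambda_t)$ for $n\ge3$. Then $m_1=0$ and $m_n=p\lambda_n$ ($n\ge2$)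 make $HT$ an $A_\infty$-algebra, a Merkulov model of $T$; all Merkulov models of $T$ are quasi-isomorphic. **The $A_\infty$-algebra $E$.** Let $BA=\bigoplus_{n\ge0}\mathfrak m^{\otimes n}$ be the bar construction, with $\mathfrak m^{\otimes n}$ in degree $-n$, deconcatenation coproduct, and $d[a_1|\cdots|a_n]=\sum_{i=2}^n(-1)^{i-1}[a_1|\cdots|a_{i-1}a_i|\cdots|a_n]$. Its graded dual $B^{\#}A$, a tensor algebra on $S^{-1}\mathfrak m^{\#}$ (i.e. $\mathfrak m^{\#}$ placed in degree 1), is a DG algebra with $\partial(f)=-(-1)^{\deg f}f\circ d$; it is quasi-isomorphic to $\mathrm{End}_A(P_A)$ for any free resolution $P_A$ of $k_A$, and its cohomology is $\mathrm{Ext}^*_A(k_A,k_A)$. This gives $E$ an $A_\infty$-structure, well defined up to quasi-isomorphism. The model of $E$ meant here is the Merkulov model of $B^{\#}A$ attached to the choices above: in degree 1, $H^1_{-s}=Q_s^{\#}$ and $L^1_{-s}=D_s^{\#}$; in degree 2, the decomposition dual to $\bigoplus_{1\le i\le s-1}A_i\otimes A_{s-i}=\mathrm{im}(d^{-3}_s)\oplus R_s\oplus\xi_s(D_s)$, namely $B^2_{-s}=(\xi_s(D_s))^{\#}$, $H^2_{-s}=R_s^{\#}$, $L^2_{-s}=(\mathrm{im}\,d^{-3}_s)^{\#}$, where $d^{-3}_s$ is the component of $d$ from $\mathfrak m^{\otimes3}$ to $\mathfrak m^{\otimes2}$ in Adams degree $s$ and $R_s\subset\bigoplus Q_i\otimes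 A_{s-i}$. *)

(* Defs.v *)
From HB Require Import structures.
From mathcomp Require Import all_boot all_order all_algebra.
From mathcomp Require Import zify.
From mathcomp Require Import boolp classical_sets functions.
Set Implicit Arguments. Unset Strict Implicit. Unset Printing Implicit Defensive.
Import GRing.Theory.
Local Open Scope quotient_scope.
Local Open Scope classical_set_scope.
Local Open Scope ring_scope.

(* Everything below is internal: graded pieces, generators, relations and
   cochains are subspaces, given as classical sets, of one ambient k-module. *)

Section Subspaces.
Variables (k : fieldType) (V : lmodType k).

Definition subspace (S : set V) : Prop :=
  S 0 /\ forall c x y, S x -> S y -> S (c *: x + y).

Definition span (S : set V) : set V := smallest subspace S.

(* S is the internal direct sum of U and W. *)
Definition direct_sum (S U W : set V) : Prop :=
  S = [set u + w | u in U & w in W] /\ U `&` W `<=` [set 0].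

Definition linear_on (W : lmodType k) (S : set V) (f : V -> W) : Prop :=
  forall c x y, S x -> S y -> f (c *: x + y) = c *: f x + f y.

Lemma subspaceZ S c x : subspace S -> S x -> S (c *: x).
Proof. by move=> [S0 SL] Sx; rewrite -[_ *: _]addr0; apply: SL. Qed.

Lemma subspaceD S x y : subspace S -> S x -> S y -> S (x + y).
Proof. by move=> [_ SL] Sx Sy; rewrite -[x]scale1r; apply: SL. Qed.

Lemma span_subspace S : subspace (span S).
Proof.
split=> [T [[]] //|c x y hx hy T hT].
by case: (hT) => -[T0 TL] _; apply: TL; [apply: hx|apply: hy].
Qed.

Lemma span_ind (S T : set V) : subspace T -> S `<=` T -> span S `<=` T.
Proof. exact: smallest_sub. Qed.

Lemma sub_span (S : set V) : S `<=` span S.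
Proof. exact: sub_gen_smallest. Qed.

End Subspaces.

Section TensorAlgebra.
Variables (k : fieldType) (V : lmodType k).

(* The tensor algebra of V: formal combinations of words in V, identified when
   every multilinear map (on words of each length) into every k-module takes
   the same value on them.  [tpure [:: v1; ...; vn]] is v1 (x) ... (x) vn, and
   [tlift f] is the linear map induced by a multilinear f ([tlift_pure],
   [tlift_linear]). *)
Definition multilinear (M : lmodType k) (f : seq V -> M) : Prop :=
  forall u v c x y,
    f (u ++ (c *: x + y) :: v) = c *: f (u ++ x :: v) + f (u ++ y :: v).

Definition fsum := seq (k * seq V).

Definition fsum_eval (M : lmodType k) (f : seq V -> M) (x : fsum) : M :=
  \sum_(c <- x) c.1 *: f c.2.

Definition fsum_eqv (x y : fsum) : bool :=
  `[< forall (M : lmodType k) (f : seq V -> M),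
        multilinear f -> fsum_eval f x = fsum_eval f y >].

Lemma fsum_eqv_equiv : equiv_class_of fsum_eqv.
Proof.
split=> [x|x y|y x z].
- by apply/asboolP.
- by apply/asboolP/asboolP=> h M f hf; rewrite h.
- by move=> /asboolP h1 /asboolP h2; apply/asboolP=> M f hf; rewrite h1 ?h2.
Qed.

Canonical fsum_equiv := EquivRelPack fsum_eqv_equiv.

Definition tensor := {eq_quot fsum_equiv}.
HB.instance Definition _ := Choice.on tensor.

Definition tensor_of (x : fsum) : tensor := \pi_tensor x.

Definition tpure (w : seq V) : tensor := tensor_of [:: (1, w)].

Definition tlift (M : lmodType k) (f : seq V -> M) (x : tensor) : M :=
  fsum_eval f (repr x).

Lemma tlift_of (M : lmodType k) (f : seq V -> M) x :
  multilinear f -> tlift f (tensor_of x) = fsum_eval f x.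
Proof.
move=> hf; rewrite /tlift /tensor_of.
have /eqmodP/asboolP h : \pi_({eq_quot fsum_equiv}) (repr (\pi_({eq_quot fsum_equiv}) x)) = \pi x by rewrite reprK.
exact: h.
Qed.

Lemma tensor_ext (x y : tensor) :
  (forall (M : lmodType k) (f : seq V -> M), multilinear f ->
     tlift f x = tlift f y) -> x = y.
Proof.
move=> h; rewrite -[x]reprK -[y]reprK; apply/eqmodP/asboolP => M f hf.
exact: h.
Qed.

Definition tadd (x y : tensor) := tensor_of (repr x ++ repr y).
Definition tscale (c : k) (x : tensor) :=
  tensor_of [seq (c * d.1, d.2) | d <- repr x].
Definition tmul (x y : tensor) :=
  tensor_of [seq (c.1 * d.1, c.2 ++ d.2) | c <- repr x, d <- repr y].

Section TLiftOps.
Variables (M : lmodType k) (f : seq V -> M) (hf : multilinear f).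

Let tliftD x y : tlift f (tadd x y) = tlift f x + tlift f y.
Proof. by rewrite tlift_of // /fsum_eval big_cat. Qed.

Let tliftZ c x : tlift f (tscale c x) = c *: tlift f x.
Proof.
rewrite tlift_of // /fsum_eval big_map scaler_sumr; apply: eq_bigr => d _.
by rewrite scalerA.
Qed.

Let tlift0 : tlift f (tensor_of [::]) = 0.
Proof. by rewrite tlift_of // /fsum_eval big_nil. Qed.

Definition tlift_ops := (tliftD, tliftZ, tlift0).

Lemma tlift_tmul x y :
  tlift f (tmul x y) = tlift (fun u => tlift (fun v => f (u ++ v)) y) x.
Proof.
rewrite tlift_of // /fsum_eval big_allpairs_dep /=; apply: eq_bigr => c _.
by rewrite scaler_sumr; apply: eq_bigr => d _; rewrite scalerA.
Qed.

Lemma multilinear_catl u : multilinear (fun v => f (u ++ v)).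
Proof. by move=> u' v c x y; rewrite !catA hf. Qed.

Lemma multilinear_catr v : multilinear (fun u => f (u ++ v)).
Proof. by move=> u v' c x y; rewrite -!catA /= hf. Qed.

Lemma tlift_pure w : tlift f (tpure w) = f w.
Proof. by rewrite tlift_of // /fsum_eval big_seq1 scale1r. Qed.

Lemma multilinear_tlift_cat y :
  multilinear (fun u => tlift (fun v => f (u ++ v)) y).
Proof.
move=> u v c a b; rewrite /tlift /fsum_eval scaler_sumr -big_split /=.
apply: eq_bigr => d _; rewrite -!catA /= hf scalerDr !scalerA.
by rewrite [c * _]mulrC.
Qed.

End TLiftOps.

Fact taddA : associative tadd.
Proof. by move=> x y z; apply: tensor_ext => M f hf; rewrite !tlift_ops // addrA. Qed.
Fact taddC : commutative tadd.
Proof. by move=> x y; apply: tensor_ext => M f hf; rewrite !tlift_ops // addrC. Qed.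
Fact tadd0 : left_id (tensor_of [::]) tadd.
Proof. by move=> x; apply: tensor_ext => M f hf; rewrite !tlift_ops // add0r. Qed.
Fact taddN : left_inverse (tensor_of [::]) (tscale (-1)) tadd.
Proof.
by move=> x; apply: tensor_ext => M f hf; rewrite !tlift_ops // scaleN1r addNr.
Qed.

HB.instance Definition _ := GRing.isZmodule.Build tensor taddA taddC tadd0 taddN.

Fact tscaleA a b v : tscale a (tscale b v) = tscale (a * b) v.
Proof. by apply: tensor_ext => M f hf; rewrite !tlift_ops // scalerA. Qed.
Fact tscale1 : left_id 1 tscale.
Proof. by move=> x; apply: tensor_ext => M f hf; rewrite !tlift_ops // scale1r. Qed.
Fact tscaleDr : right_distributive tscale +%R.
Proof. by move=> a x y; apply: tensor_ext => M f hf; rewrite !tlift_ops // scalerDr. Qed.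
Fact tscaleDl v : {morph tscale^~ v : a b / a + b}.
Proof. by move=> a b; apply: tensor_ext => M f hf; rewrite !tlift_ops // scalerDl. Qed.

HB.instance Definition _ :=
  GRing.Zmodule_isLmodule.Build k tensor tscaleA tscale1 tscaleDr tscaleDl.

Lemma tlift_linear (M : lmodType k) (f : seq V -> M) :
  multilinear f -> linear (tlift f).
Proof. by move=> hf c x y; rewrite !tlift_ops. Qed.
Lemma tliftD (M : lmodType k) (f : seq V -> M) :
  multilinear f -> {morph tlift f : x y / x + y}.
Proof. by move=> hf x y; rewrite !tlift_ops. Qed.
Lemma tliftZ (M : lmodType k) (f : seq V -> M) :
  multilinear f -> forall c, {morph tlift f : x / c *: x}.
Proof. by move=> hf c x; rewrite !tlift_ops. Qed.
Lemma tlift0 (M : lmodType k) (f : seq V -> M) :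
  multilinear f -> tlift f 0 = 0.
Proof. by move=> hf; rewrite !tlift_ops. Qed.

Lemma eq_tlift (M : lmodType k) (f g : seq V -> M) : f =1 g -> tlift f =1 tlift g.
Proof. by move=> fg x; apply: eq_bigr => c _; rewrite fg. Qed.

Fact tmulA : associative tmul.
Proof.
move=> x y z; apply: tensor_ext => M f hf; rewrite !tlift_tmul //; last first.
  exact: multilinear_tlift_cat.
apply: eq_tlift => u; rewrite tlift_tmul; last exact: multilinear_catl.
by apply: eq_tlift => v; apply: eq_tlift => w; rewrite catA.
Qed.
Fact tmul1 : left_id (tpure [::]) tmul.
Proof.
move=> x; apply: tensor_ext => M f hf; rewrite tlift_tmul // tlift_pure //.
exact: multilinear_tlift_cat.
Qed.
Fact tmulr1 : right_id (tpure [::]) tmul.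
Proof.
move=> x; apply: tensor_ext => M f hf; rewrite tlift_tmul //.
apply: eq_tlift => u; rewrite tlift_pure ?cats0 //; exact: multilinear_catl.
Qed.
Fact tmulDl : left_distributive tmul +%R.
Proof.
move=> x y z; apply: tensor_ext => M f hf.
by rewrite !(tlift_tmul, tlift_ops) //; apply: multilinear_tlift_cat.
Qed.
Fact tmulDr : right_distributive tmul +%R.
Proof.
move=> x y z; apply: tensor_ext => M f hf.
rewrite !(tlift_tmul, tlift_ops) // /tlift /fsum_eval -big_split /=.
apply: eq_bigr => c _; rewrite -scalerDr; congr (_ *: _).
exact: (tliftD (multilinear_catl hf c.2)).
Qed.
Fact tone_neq0 : tpure [::] != 0.
Proof.
apply/eqP => h; have hf : @multilinear k^o (fun w => (w == [::])%:R).
  by move=> u v c x y; case: u => [|z u] /=; rewrite scaler0 addr0.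
have := congr1 (tlift (fun w => (w == [::])%:R : k^o)) h.
by rewrite tlift_pure // tlift0 //= => /eqP; rewrite oner_eq0.
Qed.

HB.instance Definition _ :=
  GRing.Zmodule_isNzRing.Build tensor tmulA tmul1 tmulr1 tmulDl tmulDr tone_neq0.

Fact tscaleAl (a : k) (x y : tensor) : a *: (x * y) = (a *: x) * y.
Proof.
apply: tensor_ext => M f hf.
by rewrite !(tlift_tmul, tlift_ops) //; apply: multilinear_tlift_cat.
Qed.
HB.instance Definition _ := GRing.Lmodule_isLalgebra.Build k tensor tscaleAl.
Fact tscaleAr (a : k) (x y : tensor) : a *: (x * y) = x * (a *: y).
Proof.
apply: tensor_ext => M f hf.
rewrite !(tlift_tmul, tlift_ops) // /tlift /fsum_eval scaler_sumr.
apply: eq_bigr => c _; rewrite scalerA mulrC -scalerA; congr (_ *: _).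
exact: esym (tliftZ (multilinear_catl hf c.2) _ _).
Qed.
HB.instance Definition _ := GRing.Lalgebra_isAlgebra.Build k tensor tscaleAr.


Lemma tpure_multilinear : multilinear tpure.
Proof.
move=> u v c x y; apply: tensor_ext => M f hf.
by rewrite tliftD // tliftZ // !tlift_pure.
Qed.

Lemma tensorE x : x = tlift tpure x.
Proof.
apply: tensor_ext => M f hf; rewrite [tlift tpure x]/tlift /fsum_eval.
rewrite (big_morph _ (tliftD hf) (tlift0 hf)); apply: eq_bigr => c _.
by rewrite tliftZ // tlift_pure.
Qed.

End TensorAlgebra.

Arguments tpure {k V}.

Section HomogeneousWords.
Variables (k : fieldType) (V : lmodType k) (U : nat -> set V).

(* [hword n s w]: w consists of n elements, the j-th one in U (i_j) for some
   i_j >= 1, with i_1 + ... + i_n = s.  Hence [tpow n s] is (U^(x)n)_s. *)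
Inductive hword : nat -> nat -> seq V -> Prop :=
| hword_nil : hword 0 0 [::]
| hword_cons n s i v w :
    (0 < i)%N -> U i v -> hword n s w -> hword n.+1 (i + s) (v :: w).

Definition tpow (n s : nat) : set (tensor V) :=
  span [set tpure w | w in hword n s].

Lemma hword_size n s w : hword n s w -> size w = n.
Proof. by elim=> //= ? ? ? ? ? _ _ _ ->. Qed.

Lemma hword_split n s w j : hword n s w ->
  exists n1 s1 n2 s2, [/\ hword n1 s1 (take j w), hword n2 s2 (drop j w),
    (n1 + n2 = n)%N & (s1 + s2 = s)%N].
Proof.
move=> hw; elim: hw j => [|n' s' i v w' i0 Uv hw' IH] j.
  by exists 0, 0, 0, 0; split=> //; apply: hword_nil.
case: j => [|j] /=.
  exists 0, 0, n'.+1, (i + s')%N; split=> //; first exact: hword_nil.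
  exact: hword_cons.
have [n1 [s1 [n2 [s2 [h1 h2 e1 e2]]]]] := IH j.
exists n1.+1, (i + s1)%N, n2, s2; split=> //; first exact: hword_cons.
- by rewrite addSn e1.
- by rewrite -addnA e2.
Qed.

End HomogeneousWords.

Record connected_graded (k : fieldType) (A : algType k) (gr : nat -> set A) :
    Prop := ConnectedGraded {
  gr_subspace : forall i, subspace (gr i);
  gr_total : forall a, exists (n : nat) (c : nat -> A),
    (forall i, gr i (c i)) /\ a = \sum_(i < n) c i;
  gr_indep : forall (n : nat) (c : nat -> A), (forall i, gr i (c i)) ->
    \sum_(i < n) c i = 0 -> forall i, (i < n)%N -> c i = 0;
  gr_mul : forall i j a b, gr i a -> gr j b -> gr (i + j)%N (a * b);
  gr_zero : gr 0%N = [set c%:A | c in [set: k]]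
}.

Record cgAlgebra (k : fieldType) := CgAlgebra {
  cg_alg :> algType k;
  cg_gr : nat -> set cg_alg;
  cg_graded : connected_graded cg_gr
}.

Arguments cg_gr {k} _ _ _.
Arguments cg_graded {k} _.

Definition locally_finite (k : fieldType) (A : cgAlgebra k) : Prop :=
  forall i, exists l : seq A, cg_gr A i = span [set` l].

Section AugmentationIdeal.
Variables (k : fieldType) (A : cgAlgebra k).

(* The augmentation ideal of A, the direct sum of the A_i for i >= 1. *)
Definition aug_pred : {pred A} :=
  [pred a | `[< span (\bigcup_(i in [set i | (0 < i)%N]) cg_gr A i) a >]].

Fact aug_submod_closed : submod_closed aug_pred.
Proof.
have [h0 hL] := span_subspace (\bigcup_(i in [set i | (0 < i)%N]) cg_gr A i).
split=> [|c x y /asboolP hx /asboolP hy]; apply/asboolP => //.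
exact: hL.
Qed.
HB.instance Definition _ :=
  GRing.isSubmodClosed.Build k A aug_pred aug_submod_closed.

Record aug := Aug { aug_val :> A; _ : aug_val \in aug_pred }.
HB.instance Definition _ := [isSub for aug_val].
HB.instance Definition _ := [Choice of aug by <:].
HB.instance Definition _ := [SubChoice_isSubLmodule of aug by <:].

Fact aug_mul_closed (a b : A) :
  a \in aug_pred -> b \in aug_pred -> a * b \in aug_pred.
Proof.
move=> /asboolP ha /asboolP hb; apply/asboolP.
have hS := span_subspace (\bigcup_(i in [set i | (0 < i)%N]) cg_gr A i).
pose T := [set x | span (\bigcup_(i in [set i | (0 < i)%N]) cg_gr A i) (x * b)].
apply: (span_ind (T := T)) ha; rewrite /T.
  split=> [|c x y hx hy] /=; first by rewrite mul0r; case: hS.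
  by rewrite mulrDl -scalerAl; apply: hS.2.
move=> x [i /= i0 hx].
pose T' := [set y | span (\bigcup_(i in [set i | (0 < i)%N]) cg_gr A i) (x * y)].
apply: (span_ind (T := T')) hb; rewrite /T'.
  split=> [|c y z hy hz] /=; first by rewrite mulr0; case: hS.
  by rewrite mulrDr -scalerAr; apply: hS.2.
move=> y [j /= j0 hy]; apply: sub_span; exists (i + j)%N => /=.
  by rewrite addn_gt0 i0.
exact: gr_mul (cg_graded A) _ _ _ _ hx hy.
Qed.

Definition aug_mul (a b : aug) : aug :=
  Aug (aug_mul_closed (valP a) (valP b)).

Definition aug_gr (i : nat) : set aug := [set a | cg_gr A i (val a)].

End AugmentationIdeal.

Fact conv_sign (i l n : nat) : (i <= l)%N -> (l <= n)%N ->
  (i * (n - i) + (l - i) * (n - i - (l - i)) = l * (n - l) + i * (l - i))%N.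
Proof.
move=> hi hl; rewrite -(subnKC hl) -(subnKC hi).
move: (l - i)%N (n - l)%N => b a; rewrite !addKn -addnA addKn addKn; nia.
Qed.

Fact triangle_sum (M : nmodType) (F : nat -> nat -> M) n :
  \sum_(0 <= i < n.+1) \sum_(0 <= j < (n - i).+1) F i j =
  \sum_(0 <= l < n.+1) \sum_(0 <= i < l.+1) F i (l - i)%N.
Proof.
transitivity (\sum_(0 <= l < n.+1) \sum_(0 <= i < n.+1 | (i <= l)%N)
    F i (l - i)%N); last first.
  by apply: eq_big_nat => l /andP[_ hl]; rewrite [RHS](big_nat_widen _ _ n.+1).
rewrite (exchange_big_dep_nat xpredT) //=.
apply: eq_big_nat => i /andP[_ hi].
transitivity (\sum_(0 + i <= l < n.+1) F i (l - i)%N).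
  rewrite big_addn subSn //.
  by apply: eq_bigr => j _; rewrite addnK.
by rewrite add0n (big_nat_widenl i 0).
Qed.

Section Bar.
Variables (k : fieldType) (A : cgAlgebra k).
Local Notation m := (aug A).

(* [contract i w] multiplies the (0-based) entries i and i+1 of w. *)
Fixpoint contract (i : nat) (w : seq m) : seq m :=
  match i, w with
  | 0, a :: b :: w' => aug_mul a b :: w'
  | i'.+1, a :: w' => a :: contract i' w'
  | _, _ => w
  end.

(* The bar construction: the word [a1|...|an] sits in degree -n, and its Adams
   degree is the sum of those of its entries. *)
Definition bar := tensor m.

Definition bar_d : bar -> bar :=
  tlift (fun w => \sum_(i < (size w).-1) (-1) ^+ i.+1 *: tpure (contract i w)).

(* Multiplication by (-1)^n on words of length n. *)
Definition bar_sign : bar -> bar :=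
  tlift (fun w => (-1) ^+ size w *: tpure w).

Lemma aug_mul_linl (b : m) : linear (fun a => aug_mul a b).
Proof. by move=> c x y; apply: val_inj; rewrite /= mulrDl scalerAl. Qed.

Lemma aug_mul_linr (a : m) : linear (aug_mul a).
Proof. by move=> c x y; apply: val_inj; rewrite /= mulrDr scalerAr. Qed.

Lemma contract_multilinear (M : lmodType k) (f : seq m -> M) i u v c x y :
  multilinear f -> (i.+1 < size (u ++ x :: v))%N ->
  f (contract i (u ++ (c *: x + y) :: v)) =
  c *: f (contract i (u ++ x :: v)) + f (contract i (u ++ y :: v)).
Proof.
elim: i f u => [|i IH] f [|a u] hf.
- case: v => [|b v] //= _; rewrite aug_mul_linl; exact: (hf [::]).
- case: u => [|b u] /= _; first by rewrite aug_mul_linr; exact: (hf [::]).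
  exact: (hf (aug_mul a b :: u)).
- by move=> _; apply: (hf [::]).
- move=> /= hi; apply: (IH (fun w => f (a :: w))) => //.
  exact: (multilinear_catl hf [:: a]).
Qed.

Lemma bar_d_multilinear :
  multilinear (fun w : seq m =>
    \sum_(i < (size w).-1) (-1) ^+ i.+1 *: tpure (contract i w)).
Proof.
move=> u v c x y; rewrite !size_cat /= scaler_sumr -big_split /=.
apply: eq_bigr => i _; rewrite contract_multilinear; first last.
- by rewrite size_cat /= -ltn_predRL.
- exact: tpure_multilinear.
by rewrite scalerDr !scalerA mulrC.
Qed.

Lemma bar_sign_multilinear :
  multilinear (fun w : seq m => (-1) ^+ size w *: tpure w).
Proof.
move=> u v c x y; rewrite !size_cat /= tpure_multilinear.
by rewrite scalerDr !scalerA mulrC.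
Qed.

HB.instance Definition _ :=
  GRing.isLinear.Build k bar bar _ bar_d (tlift_linear bar_d_multilinear).
HB.instance Definition _ :=
  GRing.isLinear.Build k bar bar _ bar_sign (tlift_linear bar_sign_multilinear).

Lemma bar_d_pure w :
  bar_d (tpure w) =
    \sum_(i < (size w).-1) (-1) ^+ i.+1 *: tpure (contract i w).
Proof. exact: tlift_pure bar_d_multilinear w. Qed.
Lemma bar_sign_pure w : bar_sign (tpure w) = (-1) ^+ size w *: tpure w.
Proof. exact: tlift_pure bar_sign_multilinear w. Qed.

Lemma contract_hword n s i w : hword (@aug_gr k A) n s w -> (i.+1 < size w)%N ->
  hword (@aug_gr k A) n.-1 s (contract i w).
Proof.
move=> hw; elim: hw i => // {n s w} n s j a w j0 ha hw IH [|i] /=.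
  case: hw IH => // {n s w} n s l b w l0 hb hw _ _.
  rewrite addnA; apply: hword_cons => //; first by rewrite addn_gt0 j0.
  exact: gr_mul (cg_graded A) _ _ _ _ ha hb.
rewrite ltnS => hi; have := hword_cons j0 ha (IH _ hi).
by case: n {IH} hw => // /hword_size/size0nil w0; rewrite w0 in hi.
Qed.

(* The graded dual of BA: a linear form belongs to it when it vanishes on all
   but finitely many bigraded pieces; since a word of length n has Adams degree
   at least n, it is enough to bound the Adams degree. *)
Definition bar_dual_pred : {pred (bar -> k^o)} :=
  [pred phi | `[< linear (phi : bar -> k^o) /\
    exists N : nat, forall n s w, hword (@aug_gr k A) n s w -> (N <= s)%N ->
      phi (tpure w) = 0 >]].

Fact bar_dual_submod_closed : submod_closed bar_dual_pred.
Proof.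
split.
  by apply/asboolP; split=> [c x y|]; [rewrite scaler0 addr0 | exists 0%N].
move=> c f g /asboolP[fL [N hf]] /asboolP[gL [N' hg]]; apply/asboolP; split.
  move=> d x y /=; rewrite !fctE fL gL !scalerDr !scalerA (mulrC c d).
  by rewrite addrACA.
exists (maxn N N') => n s w hw; rewrite geq_max => /andP[h h'].
by rewrite !fctE (hf _ _ _ hw h) (hg _ _ _ hw h') scaler0 addr0.
Qed.
HB.instance Definition _ :=
  GRing.isSubmodClosed.Build k (bar -> k^o) bar_dual_pred bar_dual_submod_closed.

Record bar_dual := BarDual {
  bar_dual_fun :> bar -> k^o;
  _ : bar_dual_fun \in bar_dual_pred
}.
HB.instance Definition _ := [isSub for bar_dual_fun].
HB.instance Definition _ := [Choice of bar_dual by <:].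
HB.instance Definition _ := [SubChoice_isSubLmodule of bar_dual by <:].

Lemma bar_dual_linear (phi : bar_dual) : linear phi.
Proof. by have /asboolP[] := valP phi. Qed.
Lemma bar_dual_finite (phi : bar_dual) :
  exists N : nat, forall n s w, hword (@aug_gr k A) n s w -> (N <= s)%N ->
    phi (tpure w) = 0.
Proof. by have /asboolP[] := valP phi. Qed.

HB.instance Definition _ (phi : bar_dual) :=
  GRing.isLinear.Build k bar k^o _ phi (bar_dual_linear phi).

Lemma bar_dualDE (f g : bar_dual) x : (f + g) x = f x + g x.
Proof. by []. Qed.
Lemma bar_dualZE c (f : bar_dual) x : (c *: f) x = c * f x.
Proof. by []. Qed.

Lemma bar_dual_ext (f g : bar_dual) :
  (forall w, f (tpure w) = g (tpure w)) -> f = g.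
Proof.
move=> fg; apply/val_inj/funext => x /=.
by rewrite (tensorE x) /tlift /fsum_eval !linear_sum; apply: eq_bigr => c _;
   rewrite !linearZ /= fg.
Qed.

Lemma bar_dual_multilinear (f : bar_dual) :
  @multilinear k m k^o (fun w => f (tpure w)).
Proof. by move=> u v c x y; rewrite tpure_multilinear linearP. Qed.

Fact bar_diff_subproof (phi : bar_dual) :
  (fun x => phi (bar_d (bar_sign x))) \in bar_dual_pred.
Proof.
apply/asboolP; split.
  by move=> c x y; rewrite !linearP.
have [N hN] := bar_dual_finite phi; exists N => n s w hw hs.
rewrite bar_sign_pure linearZ /= bar_d_pure linearZ /= linear_sum big1 ?scaler0 // => i _.
rewrite linearZ /= (hN n.-1 s) ?scaler0 //.
by apply: contract_hword hw _; rewrite -ltn_predRL.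
Qed.
(* del phi = - (-1)^n phi o d for phi of degree n.  The degree n component of
   phi sees d w only if w has length n+1, hence the sign (-1)^(size w). *)
Definition bar_diff (phi : bar_dual) : bar_dual :=
  BarDual (bar_diff_subproof phi).

Fact bar_dual_sign_subproof (phi : bar_dual) :
  (fun x => phi (bar_sign x)) \in bar_dual_pred.
Proof.
apply/asboolP; split.
  by move=> c x y; rewrite !linearP.
have [N hN] := bar_dual_finite phi; exists N => n s w hw hs.
by rewrite bar_sign_pure linearZ /= (hN _ _ _ hw hs) scaler0.
Qed.
(* phi |-> (-1)^n phi for phi of degree n. *)
Definition bar_dual_sign (phi : bar_dual) : bar_dual :=
  BarDual (bar_dual_sign_subproof phi).

(* The product dual to deconcatenation, with the Koszul sign
   (phi (x) psi)(x (x) y) = (-1)^(|psi| |x|) phi(x) psi(y); it is the one for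
   which [bar_diff] is a derivation. *)
Definition bar_conv (phi psi : bar_dual) (w : seq m) : k^o :=
  \sum_(j < (size w).+1) (-1) ^+ (j * (size w - j)) *
     (phi (tpure (take j w)) * psi (tpure (drop j w))).

Lemma bar_conv_multilinear phi psi : multilinear (bar_conv phi psi).
Proof.
move=> u v c x y; rewrite /bar_conv !size_cat /= scaler_sumr -big_split /=.
apply: eq_bigr => j _; rewrite !take_cat !drop_cat.
case: ltnP => hj.
  rewrite (bar_dual_multilinear psi) mulrDr mulrDr; congr (_ + _).
  by rewrite /GRing.scale /= !(mulrCA c).
case: (j - size u)%N => [|l] /=.
  rewrite (bar_dual_multilinear psi [::]) mulrDr mulrDr; congr (_ + _).
  by rewrite /GRing.scale /= !(mulrCA c).
rewrite (bar_dual_multilinear phi) mulrDl mulrDr; congr (_ + _).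
by rewrite /GRing.scale /= -(mulrA c) mulrCA.
Qed.

Fact bar_dual_mul_subproof (phi psi : bar_dual) :
  tlift (bar_conv phi psi) \in bar_dual_pred.
Proof.
apply/asboolP; split; first exact/tlift_linear/bar_conv_multilinear.
have [N hN] := bar_dual_finite phi; have [N' hN'] := bar_dual_finite psi.
exists (N + N')%N => n s w hw hs.
rewrite tlift_pure; last exact: bar_conv_multilinear.
rewrite /bar_conv big1 // => j _.
have [n1 [s1 [n2 [s2 [h1 h2 _ es]]]]] := hword_split j hw.
case: (leqP N s1) => h; first by rewrite (hN _ _ _ h1 h) mul0r mulr0.
rewrite (hN' _ _ _ h2) ?mulr0 //.
by rewrite -(leq_add2l N) (leq_trans hs) // -es leq_add2r ltnW.
Qed.
Definition bar_dual_mul (phi psi : bar_dual) : bar_dual :=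
  BarDual (bar_dual_mul_subproof phi psi).

Lemma bar_dual_mulE phi psi w :
  bar_dual_mul phi psi (tpure w) = bar_conv phi psi w.
Proof. by rewrite /= tlift_pure //; apply: bar_conv_multilinear. Qed.

Lemma nil_multilinear : @multilinear k m k^o (fun w => (w == [::])%:R).
Proof. by move=> u v c x y; case: u => [|z u] /=; rewrite scaler0 addr0. Qed.

Fact bar_dual_one_subproof :
  tlift (fun w : seq m => (w == [::])%:R : k^o) \in bar_dual_pred.
Proof.
apply/asboolP; split; first exact/tlift_linear/nil_multilinear.
exists 1%N => n s w hw hs; rewrite tlift_pure; last exact: nil_multilinear.
by case: hw hs.
Qed.
Definition bar_dual_one : bar_dual := BarDual bar_dual_one_subproof.

Lemma bar_dual_oneE w : bar_dual_one (tpure w) = (w == [::])%:R.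
Proof. exact: tlift_pure nil_multilinear w. Qed.

Fact bar_dual_mulDl : left_distributive bar_dual_mul +%R.
Proof.
move=> f g h; apply: bar_dual_ext => w.
rewrite bar_dualDE !bar_dual_mulE /bar_conv -big_split /=.
by apply: eq_bigr => j _; rewrite -mulrDr -mulrDl.
Qed.
Fact bar_dual_mulDr : right_distributive bar_dual_mul +%R.
Proof.
move=> f g h; apply: bar_dual_ext => w.
rewrite bar_dualDE !bar_dual_mulE /bar_conv -big_split /=.
by apply: eq_bigr => j _; rewrite -mulrDr -mulrDr.
Qed.
Fact bar_dual_scaleAl (c : k) f g :
  c *: bar_dual_mul f g = bar_dual_mul (c *: f) g.
Proof.
apply: bar_dual_ext => w; rewrite bar_dualZE !bar_dual_mulE mulr_sumr.
by apply: eq_bigr => j _; rewrite bar_dualZE -mulrA (mulrCA c).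
Qed.
Fact bar_dual_scaleAr (c : k) f g :
  c *: bar_dual_mul f g = bar_dual_mul f (c *: g).
Proof.
apply: bar_dual_ext => w; rewrite bar_dualZE !bar_dual_mulE mulr_sumr.
by apply: eq_bigr => j _; rewrite bar_dualZE !(mulrCA c).
Qed.
Fact bar_dual_mul1 : left_id bar_dual_one bar_dual_mul.
Proof.
move=> f; apply: bar_dual_ext => w; rewrite bar_dual_mulE /bar_conv.
rewrite big_ord_recl take0 drop0 bar_dual_oneE eqxx !mul1r big1 ?addr0 //.
move=> j _; rewrite bar_dual_oneE lift0.
by case: w j => [|a w] [j hj] //; rewrite mul0r mulr0.
Qed.
Fact bar_dual_mulr1 : right_id bar_dual_one bar_dual_mul.
Proof.
move=> f; apply: bar_dual_ext => w; rewrite bar_dual_mulE /bar_conv.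
rewrite big_ord_recr take_size drop_size bar_dual_oneE eqxx subnn muln0.
rewrite mulr1 mul1r big1; first exact: add0r.
move=> j _.
rewrite bar_dual_oneE -size_eq0 size_drop subn_eq0 leqNgt.
rewrite [(_ < _)%N](ltn_ord j).
by rewrite !mulr0.
Qed.
Fact bar_dual_mulA : associative bar_dual_mul.
Proof.
move=> f g h; apply: bar_dual_ext => w; rewrite !bar_dual_mulE /bar_conv.
pose n := size w.
pose F i j := (-1) ^+ (i * (n - i) + j * (n - i - j)) *
  (f (tpure (take i w)) * (g (tpure (take j (drop i w))) *
   h (tpure (drop (i + j) w)))) : k.
transitivity (\sum_(0 <= i < n.+1) \sum_(0 <= j < (n - i).+1) F i j).
  rewrite big_mkord; apply: eq_bigr => i _; rewrite bar_dual_mulE /bar_conv.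
  rewrite !mulr_sumr size_drop big_mkord; apply: eq_bigr => j _.
  rewrite /F drop_drop [(j + i)%N]addnC exprD -/n -[RHS]mulrA; congr (_ * _).
  by rewrite mulrCA.
transitivity (\sum_(0 <= l < n.+1) \sum_(0 <= i < l.+1) F i (l - i)%N); last first.
  rewrite big_mkord; apply: eq_bigr => l _; rewrite bar_dual_mulE /bar_conv.
  have hl : (l <= n)%N by rewrite -ltnS.
  rewrite mulr_suml mulr_sumr size_takel // big_mkord; apply: eq_bigr => i _.
  have hi : (i <= l)%N by rewrite -ltnS.
  rewrite /F take_takel // subnKC //.
  have -> : take (l - i) (drop i w) = drop i (take l w).
    by rewrite take_drop subnK.
  rewrite -/n !mulrA -!exprD; congr (_ * _ * _ * _); congr (_ ^+ _).
  by rewrite conv_sign.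
exact: triangle_sum.
Qed.

Fact bar_dual_one_neq0 : bar_dual_one != 0.
Proof.
apply/eqP => /(congr1 (fun f : bar_dual => f (tpure [::]))).
by rewrite bar_dual_oneE => /eqP; rewrite oner_eq0.
Qed.

HB.instance Definition _ := GRing.Zmodule_isNzRing.Build bar_dual
  bar_dual_mulA bar_dual_mul1 bar_dual_mulr1 bar_dual_mulDl bar_dual_mulDr
  bar_dual_one_neq0.
HB.instance Definition _ :=
  GRing.Lmodule_isLalgebra.Build k bar_dual bar_dual_scaleAl.
HB.instance Definition _ :=
  GRing.Lalgebra_isAlgebra.Build k bar_dual bar_dual_scaleAr.

Fact bar_diff_linear : linear bar_diff.
Proof. by move=> c f g; exact: val_inj. Qed.
HB.instance Definition _ :=
  GRing.isLinear.Build k bar_dual bar_dual _ bar_diff bar_diff_linear.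

Fact bar_dual_sign_linear : linear bar_dual_sign.
Proof. by move=> c f g; exact: val_inj. Qed.
HB.instance Definition _ :=
  GRing.isLinear.Build k bar_dual bar_dual _ bar_dual_sign bar_dual_sign_linear.

(* Forms of cohomological degree n and Adams degree a: (m^(x)p)_t is dual to
   bidegree (p, -t). *)
Definition bar_dual_comp (n a : int) : set bar_dual :=
  [set phi | forall m t w, hword (@aug_gr k A) m t w ->
     (m%:Z, - t%:Z) <> (n, a) -> phi (tpure w) = 0].

End Bar.

Section Merkulov.
Variables (k : fieldType) (X : algType k).
(* A DG algebra with underlying algebra X: [comp n a] is its piece of degree n
   and Adams degree a, [del] its differential and [sg] the operator
   x |-> (-1)^n x for x of degree n. *)
Variables (comp : int -> int -> set X) (del sg : X -> X).

Definition coboundary (n a : int) : set X := del @` comp (n - 1) a.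
Definition cocycle (n a : int) : set X := comp n a `&` [set x | del x = 0].

Record merkulov_data (H L : int -> int -> set X) (G p : {linear X -> X}) :
    Prop := MerkulovData {
  merkulov_H : forall n a, subspace (H n a);
  merkulov_L : forall n a, subspace (L n a);
  merkulov_Z : forall n a,
    direct_sum (cocycle n a) (coboundary n a) (H n a);
  merkulov_T : forall n a,
    direct_sum (comp n a) (cocycle n a) (L n a);
  merkulov_GH : forall n a x, H n a x -> G x = 0;
  merkulov_GL : forall n a x, L n a x -> G x = 0;
  merkulov_GB : forall n a x, L n a x -> G (del x) = x;
  merkulov_pB : forall n a x, coboundary n a x -> p x = 0;
  merkulov_pL : forall n a x, L n a x -> p x = 0;
  merkulov_pH : forall n a x, H n a x -> p x = x
}.

Variables G p : {linear X -> X}.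

(* lambda_n(x1, ..., xn) for n = size xs <= N; N only ensures termination.
   Since G lambda_t has degree 1 - t, the Koszul sign of
   (G lambda_s (x) G lambda_t)(x1, ..., xn) is (-1)^((1 - t)(|x1|+...+|xs|)):
   it is produced by applying sg^(t+1) to each of x1, ..., xs. *)
Fixpoint lambda_rec (N : nat) (xs : seq X) : X :=
  if N isn't N'.+1 then 0 else
  let Glambda ys := if ys is [:: y] then - y else G (lambda_rec N' ys) in
  if xs is [:: x; y] then x * y else
  \sum_(1 <= s < size xs)
    (-1) ^+ s.+1 * (Glambda [seq iter (size xs - s).+1 sg x | x <- take s xs]
                    * Glambda (drop s xs)).

Definition merkulov_lambda (xs : seq X) : X := lambda_rec (size xs) xs.

(* m_n as a linear map on n-fold tensors; m_1 = 0. *)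
Definition merkulov_m (n : nat) : tensor X -> X :=
  tlift (fun xs => if (1 < n)%N && (size xs == n) then p (merkulov_lambda xs)
                   else 0).

End Merkulov.

Section Generators.
Variables (k : fieldType) (A : cgAlgebra k).

Definition bar_mult : bar A -> A := tlift (fun w => \prod_(a <- w) aug_val a).

Variable Q : nat -> set (aug A).

(* The sum of the Q_i (x) A_(s-i) for 0 < i < s, inside m (x) m. *)
Definition QA (s : nat) : set (bar A) :=
  span [set x | exists i q a, [/\ (0 < i < s)%N, Q i q, aug_gr (s - i) a
                                & x = tpure [:: q; a]]].

(* D_s; for s = 1 it is 0, because QA 1 is, so that a generating space has
   Q_1 = A_1. *)
Definition decomposables (s : nat) : set (aug A) :=
  [set a | exists2 x, QA s x & bar_mult x = aug_val a].

Definition generating_space : Prop :=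
  forall s, (0 < s)%N ->
    subspace (Q s) /\ direct_sum (aug_gr s) (decomposables s) (Q s).

Definition splitting (xi : nat -> aug A -> bar A) : Prop :=
  forall s, (1 < s)%N ->
    [/\ linear_on (decomposables s) (xi s),
        forall a, decomposables s a -> QA s (xi s a)
      & forall a, decomposables s a -> bar_mult (xi s a) = aug_val a].

(* id (x) theta on m (x) m. *)
Definition id_tensor (theta : aug A -> bar A) : bar A -> bar A :=
  tlift (fun w => if w is [:: q; a] then tpure [:: q] * theta a else 0).

(* The maps theta_s, for s >= 1, assembled into one linear map on m. *)
Definition theta_embedding (xi : nat -> aug A -> bar A)
    (theta : {linear aug A -> bar A}) : Prop :=
  (forall s q, (0 < s)%N -> Q s q -> theta q = tpure [:: q]) /\
  (forall s a, (1 < s)%N -> decomposables s a ->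
     theta a = id_tensor theta (xi s a)).

(* The tensor algebra on Q, as a subalgebra of the one on m. *)
Definition TQ : set (bar A) :=
  span [set x | exists n s w, hword Q n s w /\ x = tpure w].

Definition TQ_gr (s : nat) : set (bar A) :=
  span [set x | exists n w, hword Q n s w /\ x = tpure w].

Definition TQ_kernel : set (bar A) := TQ `&` [set x | bar_mult x = 0].

Definition TQ_ideal (R : nat -> set (bar A)) : set (bar A) :=
  span [set x | exists s u r v, [/\ TQ u, R s r, TQ v & x = u * r * v]].

Definition generates_relations (R : nat -> set (bar A)) : Prop :=
  (forall s, subspace (R s) /\ R s `<=` TQ_gr s) /\ TQ_ideal R = TQ_kernel.

Definition minimal_relations (R : nat -> set (bar A)) : Prop :=
  generates_relations R /\
  forall R', generates_relations R' -> (forall s, R' s `<=` R s) ->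
    forall s, R' s = R s.

End Generators.

Section Pairing.
Variables (k : fieldType) (A : cgAlgebra k).

Definition length_proj (n : nat) : bar A -> bar A :=
  tlift (fun w => if size w == n then tpure w else 0).

(* If (m^(x)n)_s = U (+) W then U^# is identified with the forms of bidegree
   (n, -s) vanishing on W. *)
Definition bar_ann (n a : int) (S : set (bar A)) : set (bar_dual A) :=
  bar_dual_comp n a `&` [set phi | forall x, S x -> phi x = 0].

(* The identification of tensors of degree 1 cochains with forms on tensors:
   f1 (x) ... (x) fn sends q1 (x) ... (x) qn to
   (-1)^(n(n-1)/2) f1(q1) ... fn(qn).  The sign is the Koszul sign, the f_j
   being of degree 1 and the q_j of degree -1; it is also the value of the
   product f1 ... fn of the dual of BA on [q1|...|qn]. *)
Definition tensor_pairing (u : tensor (bar_dual A)) (x : bar A) : k :=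
  tlift (fun fs : seq (bar_dual A) => tlift (fun w : seq (aug A) =>
    (if size fs == size w then
       (-1) ^+ 'C(size w, 2) * \prod_(fw <- zip fs w) fw.1 (tpure [:: fw.2])
     else 0) : k^o) x) u.

End Pairing.

(* Main.v *)
Require Import Defs.
From mathcomp Require Import all_boot all_order all_algebra.
From mathcomp Require Import boolp classical_sets functions.
Import GRing.Theory.
Local Open Scope classical_set_scope.
Local Open Scope ring_scope.

(** Write g_1 = - id and g_n = G lambda_n for n > 1, and let f1, ..., fn be
    degree 1 classes.  A degree 1 cochain lying in L^1 vanishes on generators,
    and g_j(f1, ..., fj) lies in L^1 as soon as j > 1.  Hence, when lambda_n is
    evaluated on [q|a] with q a generator, all the terms g_s g_t of Merkulov's
    sum die except the one with s = 1 ([lambda_pair]):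

      lambda_n(f1, ..., fn)[q|a] = (-1)^n f1(q) g_(n-1)(f2, ..., fn)(a).

    On the other hand lambda_n and the coboundary of g_n agree on xi(d), because
    the H and L components of a degree 2 cochain vanish there, and the coboundary
    of a degree 1 cochain phi is [a|b] |-> - phi(ab).  So
    g_n(d) = - lambda_n(xi(d)) for d decomposable ([Glambda_decomposable]).

    These two recursions are the ones that define theta: theta(q) = [q] on
    generators and theta(d) = (id (x) theta)(xi(d)) on decomposables.  By
    induction on n, g_n(f1, ..., fn) is - (-1)^(n(n-1)/2) times evaluation of
    f1 (x) ... (x) fn on theta ([Glambda_theta]), and lambda_n(f1, ..., fn) is
    (-1)^(n(n-1)/2) times its evaluation on id (x) theta ([lambda_QA]).

    Finally m_n = p lambda_n and lambda_n have the same values on R: L^2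
    vanishes on R by its choice, and coboundaries do because an element of R
    multiplies to 0 in A, theta being a section of the multiplication
    ([theta_splits], [relation_bar_mult]).  The sign (-1)^(n(n-1)/2) is the
    Koszul sign of the pairing of (E^1)^(x)n with Q^(x)n. *)

(** * Multilinear maps and Merkulov's recursion *)

Section Multilinear.
Set Implicit Arguments. Unset Strict Implicit.
Variables (k : fieldType) (V : lmodType k).

Lemma linear_at0 (W M : lmodType k) (f : W -> M) : linear f -> f 0 = 0.
Proof.
by move=> fL; have := fL (-1) 0 0; rewrite !scaler0 !addr0 scaleN1r addNr.
Qed.

Lemma linear_ext_tensor (M : lmodType k) (f g : tensor V -> M) :
  linear f -> linear g -> (forall w, f (tpure w) = g (tpure w)) -> f =1 g.
Proof.
move=> fL gL fg x; rewrite (tensorE x) /tlift /fsum_eval.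
elim: (repr x) => [|c s IH].
  by rewrite big_nil (linear_at0 fL) (linear_at0 gL).
by rewrite big_cons fL gL IH fg.
Qed.

Lemma tpureM (w w' : seq V) : tpure w * tpure w' = tpure (w ++ w').
Proof.
apply: tensor_ext => M f hf; rewrite tlift_tmul // !tlift_pure //.
  exact: multilinear_catl.
exact: multilinear_tlift_cat.
Qed.

Lemma multilinear_map (M : lmodType k) (f : seq V -> M) (g : V -> V) :
  linear g -> multilinear f -> multilinear (fun w => f (map g w)).
Proof. by move=> gL hf u v c x y; rewrite !map_cat /= gL hf. Qed.

Lemma multilinear_tlift (W M : lmodType k) (f : seq V -> seq W -> M) y :
  (forall w, multilinear (f ^~ w)) -> multilinear (fun v => tlift (f v) y).
Proof.
move=> hf u v c a b; rewrite /tlift /fsum_eval scaler_sumr -big_split /=.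
by apply: eq_bigr => d _; rewrite hf scalerDr !scalerA mulrC.
Qed.

Lemma hword_map (U : nat -> set V) (g : V -> V) n s w :
  (forall i v, U i v -> U i (g v)) -> hword U n s w -> hword U n s (map g w).
Proof.
by move=> hg; elim=> [|{}n {}s i v {}w i0 hv hw IH]; constructor; auto.
Qed.

Lemma hword_consE (U : nat -> set V) n s v w : hword U n s (v :: w) ->
  exists n' i s', [/\ n = n'.+1, s = (i + s')%N, (0 < i)%N, U i v
    & hword U n' s' w].
Proof.
move=> h; inversion h as [|n' s' i v' w' i0 Uv hw en es ev].
by exists n', i, s'.
Qed.

Lemma hword_nilE (U : nat -> set V) n s : hword U n s [::] -> n = 0%N /\ s = 0%N.
Proof. by move=> h; inversion h. Qed.

Lemma multilinear_split (X : algType k) (f g : seq V -> X) j :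
  multilinear f -> multilinear g ->
  multilinear (fun w => f (take j w) * g (drop j w)).
Proof.
move=> hf hg u v c x y; rewrite !take_cat !drop_cat.
case: ltnP => hj; first by rewrite hg mulrDr scalerAr.
(* The modified entry opens the second half exactly when j = size u. *)
case: (j - size u)%N => [|l] /=.
  by rewrite (hg [::]) mulrDr scalerAr.
by rewrite hf mulrDl scalerAl.
Qed.

End Multilinear.

Section Lambda.
Set Implicit Arguments. Unset Strict Implicit.
Variables (k : fieldType) (X : algType k) (sg G p : {linear X -> X}).
Hypothesis sgK : involutive sg.

Definition Glambda N (ys : seq X) : X :=
  if ys is [:: y] then - y else G (lambda_rec sg G N ys).

(** Since g_1 = - id and sg is an involution, the product x y is also the only
    term of the general sum for two arguments, so that one formula covers all
    lengths; in the general term, sg is applied size xs - s + 1 times because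
    G lambda_t shifts degrees by 1 - t, with t = size xs - s. *)
Lemma lambda_recE N xs : lambda_rec sg G N.+1 xs =
  \sum_(1 <= s < size xs) (-1) ^+ s.+1 *
    (Glambda N (map (iter (size xs - s).+1 sg) (take s xs))
     * Glambda N (drop s xs)).
Proof.
case: xs => [|x [|y [|z xs]]] //=; rewrite big_nat1 /= sgK mulrNN.
by rewrite -signr_odd /= mul1r.
Qed.

Lemma iter_linear n : linear (iter n sg).
Proof. by elim: n => [|n IH] c x y //=; rewrite IH linearP. Qed.

Lemma Glambda_multilinear N :
  multilinear (lambda_rec sg G N) -> multilinear (Glambda N).
Proof.
move=> h u v c x y; rewrite /Glambda.
case: u => [|a [|b u]]; last by rewrite /= (h [:: a, b & u]) linearP.
  case: v => [|b v]; first by rewrite /= opprD scalerN.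
  by rewrite /= (h [::]) linearP.
by case: v => [|b v]; rewrite /= (h [:: a]) linearP.
Qed.

Lemma lambda_rec_multilinear N : multilinear (lambda_rec sg G N).
Proof.
elim: N => [|N IH] u v c x y; first by rewrite scaler0 addr0.
rewrite !lambda_recE !size_cat /= scaler_sumr -big_split /=.
apply: eq_bigr => s _; set e := (_ - s).+1.
rewrite scalerAr -mulrDr; congr (_ * _).
have hG := Glambda_multilinear IH.
exact: (multilinear_split s (multilinear_map (iter_linear e) hG) hG).
Qed.

Lemma merkulov_m_multilinear n : multilinear (fun xs : seq X =>
  if (1 < n)%N && (size xs == n) then p (merkulov_lambda sg G xs) else 0).
Proof.
move=> u v c x y; rewrite !size_cat /=.
case: ifP => _; last by rewrite scaler0 addr0.
by rewrite /merkulov_lambda !size_cat /= lambda_rec_multilinear linearP.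
Qed.

End Lambda.

Section Decomposition.
Set Implicit Arguments. Unset Strict Implicit.
Variables (k : fieldType) (X : algType k) (comp : int -> int -> set X).
Variables (del : {linear X -> X}) (H L : int -> int -> set X).
Variables (G p : {linear X -> X}).
Hypothesis hM : merkulov_data comp del H L G p.

(** The part y in L of a primitive of the coboundary component of x is what the
    homotopy G recovers, while p picks the component in H. *)
Lemma merkulov_decomposition n a x : comp n a x -> exists y h l,
  [/\ L (n - 1) a y, H n a h, L n a l, x = del y + h + l & G x = y /\ p x = h].
Proof.
have [-> _] := merkulov_T hM n a => -[z + [l Ll <-{x}]].
have [-> _] := merkulov_Z hM n a => -[b cob [h Hh <-{z}]].
have pb := merkulov_pB hM cob; case: cob pb => y' + <-{b}.
have [-> _] := merkulov_T hM (n - 1) a => -[z [_ /= dz] [y Ly <-{y'}]].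
rewrite linearD dz add0r => pb.
exists y, h, l; split=> //; rewrite !linearD /=.
rewrite (merkulov_GB hM Ly) (merkulov_GH hM Hh) (merkulov_GL hM Ll).
by rewrite pb (merkulov_pH hM Hh) (merkulov_pL hM Ll) !addr0 add0r.
Qed.

End Decomposition.

(** * Cochains on the bar construction and their pairing with tensors *)

Section Cochains.
Set Implicit Arguments. Unset Strict Implicit.
Variables (k : fieldType) (A : cgAlgebra k).
Local Notation X := (bar_dual A).
Local Notation comp := (@bar_dual_comp k A).
Local Notation sg := (@bar_dual_sign k A).

Lemma bar_dual_signE (f : X) w : sg f (tpure w) = (-1) ^+ size w * f (tpure w).
Proof. by rewrite /= bar_sign_pure linearZ. Qed.

Lemma bar_dual_signK : involutive sg.
Proof.
move=> f; apply: bar_dual_ext => w.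
by rewrite !bar_dual_signE mulrA -exprD addnn -signr_odd odd_double mul1r.
Qed.

Lemma iter_bar_dual_signE n (f : X) a :
  iter n sg f (tpure [:: a]) = (-1) ^+ n * f (tpure [:: a]).
Proof.
elim: n => [|n IH]; first by rewrite mul1r.
by rewrite iterS bar_dual_signE IH expr1 mulrA exprS.
Qed.

Lemma sign_mulrE (X' : algType k) n (f : X') : (-1) ^+ n * f = (-1) ^+ n *: f.
Proof.
by rewrite -(signr_odd X') -(signr_odd k) mulr_sign scaler_sign.
Qed.

Lemma bar_dualME (f g : X) w : (f * g) (tpure w) = bar_conv f g w.
Proof. exact: bar_dual_mulE. Qed.

Lemma bar_dual_sumE I (r : seq I) (P : pred I) (F : I -> X) x :
  (\sum_(i <- r | P i) F i) x = \sum_(i <- r | P i) F i x.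
Proof. by elim/big_rec2: _ => // i y f _ <-. Qed.

Lemma bar_dual_comp_subspace n a : subspace (comp n a).
Proof.
split=> [m t w _ _ //|c f g hf hg m t w hw hne].
by rewrite bar_dualDE bar_dualZE (hf m t) // (hg m t) // mulr0 addr0.
Qed.

Lemma bar_dual_compM m n a b f g :
  comp m a f -> comp n b g -> comp (m + n) (a + b) (f * g).
Proof.
move=> hf hg l t w hw hne; rewrite bar_dualME /bar_conv big1 // => j _.
have [n1 [s1 [n2 [s2 [h1 h2 en es]]]]] := hword_split j hw.
have [[e1 e2]|h] := pselect ((n1%:Z, - s1%:Z) = (m, a)); last first.
  by rewrite (hf _ _ _ h1 h) mul0r mulr0.
have [[e3 e4]|h] := pselect ((n2%:Z, - s2%:Z) = (n, b)); last first.
  by rewrite (hg _ _ _ h2 h) !mulr0.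
by case: hne; rewrite -en -es !PoszD opprD e1 e2 e3 e4.
Qed.

Lemma bar_dual_comp_nil n a f : comp n a f -> n != 0 -> f (tpure [::]) = 0.
Proof.
move=> hf n0; apply: hf (hword_nil _) _ => -[e _].
by rewrite -e eqxx in n0.
Qed.

Lemma bar_dual_comp1 n a j q f : comp n a f -> (0 < j)%N -> aug_gr j q ->
  a != - j%:Z -> f (tpure [:: q]) = 0.
Proof.
move=> hf j0 hq; have hw := hword_cons j0 hq (hword_nil (@aug_gr k A)).
by rewrite addn0 in hw; move=> /eqP ha; apply: hf hw _ => -[_ /esym].
Qed.

(** Degree 1 cochains vanish on the empty word, so only the middle cut of
    [q|x] contributes; the sign is the Koszul sign of moving g past q. *)
Lemma bar_dualM_pair a b f g q x : comp 1 a f -> comp 1 b g ->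
  (f * g) (tpure [:: q; x]) = - (f (tpure [:: q]) * g (tpure [:: x])).
Proof.
move=> hf hg; rewrite bar_dualME /bar_conv !big_ord_recl big_ord0 /=.
rewrite (bar_dual_comp_nil hf) // (bar_dual_comp_nil hg) //.
by rewrite mul0r !mulr0 add0r !addr0 /bump /= mulN1r.
Qed.

Lemma bar_diff_pair (f : X) (a b : aug A) :
  bar_diff f (tpure [:: a; b]) = - f (tpure [:: aug_mul a b]).
Proof.
rewrite /= bar_sign_pure linearZ /= bar_d_pure /= big_ord1 /=.
by rewrite scaleN1r !linearN /= sqrrN expr1n scale1r.
Qed.

Lemma bar_mult_multilinear :
  @multilinear k (aug A) A (fun w => \prod_(a <- w) aug_val a).
Proof.
move=> u v c x y; rewrite !big_cat !big_cons /=.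
by rewrite mulrDl mulrDr -!scalerAl -scalerAr.
Qed.

Lemma bar_mult_linear : linear (@bar_mult k A).
Proof. exact: tlift_linear bar_mult_multilinear. Qed.

Lemma bar_mult_pure (w : seq (aug A)) :
  bar_mult (tpure w) = \prod_(a <- w) aug_val a.
Proof. exact: tlift_pure bar_mult_multilinear w. Qed.

Lemma bar_multM (x y : bar A) : bar_mult (x * y) = bar_mult x * bar_mult y.
Proof.
move: x; apply: linear_ext_tensor => [c u v|c u v|w].
- by rewrite mulrDl -scalerAl bar_mult_linear.
- by rewrite bar_mult_linear mulrDl -scalerAl.
move: y; apply: linear_ext_tensor => [c u v|c u v|w'].
- by rewrite mulrDr -scalerAr bar_mult_linear.
- by rewrite bar_mult_linear mulrDr -scalerAr.
by rewrite tpureM !bar_mult_pure big_cat.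
Qed.

(** The pairing without its Koszul sign, by a recursion on words that follows
    the one defining theta. *)
Fixpoint eval_word (fs : seq X) (w : seq (aug A)) : k^o :=
  match fs, w with
  | [::], [::] => 1
  | f :: fs', a :: w' => f (tpure [:: a]) * eval_word fs' w'
  | _, _ => 0
  end.

Lemma eval_word_multilinear fs : multilinear (eval_word fs).
Proof.
move=> u v c x y; elim: fs u => [|f fs IH] [|a u] /=.
- by rewrite scaler0 addr0.
- by rewrite scaler0 addr0.
- by rewrite (bar_dual_multilinear f [::]) mulrDl scalerAl.
- by rewrite IH mulrDr scalerAr.
Qed.

Lemma eval_word_multilinear_forms w : multilinear (eval_word ^~ w).
Proof.
move=> u v c x y; elim: w u => [|a w IH] [|f u] /=.
- by rewrite scaler0 addr0.
- by rewrite scaler0 addr0.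
- rewrite [X in X * _](_ : _ = c * x (tpure [:: a]) + y (tpure [:: a])) //.
  by rewrite mulrDl -mulrA.
- by rewrite IH mulrDr scalerAr.
Qed.

Lemma eval_wordE fs w : eval_word fs w =
  if size fs == size w then \prod_(fw <- zip fs w) fw.1 (tpure [:: fw.2]) else 0.
Proof.
elim: fs w => [|f fs IH] [|a w] //=; first by rewrite big_nil.
by rewrite IH eqSS; case: ifP => _; rewrite ?mulr0 // big_cons.
Qed.

Definition eval_tensor fs : bar A -> k^o := tlift (eval_word fs).

Lemma eval_tensor_linear fs : linear (eval_tensor fs).
Proof. exact: tlift_linear (eval_word_multilinear fs). Qed.

Lemma eval_tensor_pure fs w : eval_tensor fs (tpure w) = eval_word fs w.
Proof. exact: tlift_pure (eval_word_multilinear fs) w. Qed.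

Lemma eval_tensor_nil a x : eval_tensor [::] (tpure [:: a] * x) = 0.
Proof.
rewrite /eval_tensor tlift_tmul; last exact: eval_word_multilinear.
rewrite tlift_pure; last exact/multilinear_tlift_cat/eval_word_multilinear.
by rewrite /tlift /fsum_eval big1 // => c _; rewrite scaler0.
Qed.

(** This multiplicativity is the step that matches the recursive definition of
    theta with the recursion satisfied by the higher products. *)
Lemma eval_tensor_cons f fs a x : eval_tensor (f :: fs) (tpure [:: a] * x) =
  f (tpure [:: a]) * eval_tensor fs x.
Proof.
rewrite /eval_tensor tlift_tmul; last exact: eval_word_multilinear.
rewrite tlift_pure; last exact/multilinear_tlift_cat/eval_word_multilinear.
rewrite /tlift /fsum_eval /= mulr_sumr; apply: eq_bigr => c _.
by rewrite /GRing.scale /= mulrCA.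
Qed.

Lemma length_proj_multilinear n : @multilinear k (aug A) (bar A)
  (fun w => if size w == n then tpure w else 0).
Proof.
move=> u v c x y; rewrite !size_cat /=; case: ifP => _.
  exact: tpure_multilinear.
by rewrite scaler0 addr0.
Qed.

Lemma signed_eval_wordE (fs : seq X) w :
  (if size fs == size w then (-1) ^+ 'C(size w, 2) *
     \prod_(fw <- zip fs w) fw.1 (tpure [:: fw.2]) else 0) =
  (-1) ^+ 'C(size fs, 2) * eval_word fs w :> k^o.
Proof. by rewrite eval_wordE; case: eqP => [->|_]; rewrite ?mulr0. Qed.

Lemma pairing_multilinear (w : seq (aug A)) : multilinear (fun fs : seq X =>
  (if size fs == size w then
     (-1) ^+ 'C(size w, 2) * \prod_(fw <- zip fs w) fw.1 (tpure [:: fw.2])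
   else 0) : k^o).
Proof.
move=> u v c x y; rewrite !signed_eval_wordE (eval_word_multilinear_forms w).
by rewrite !size_cat mulrDr scalerAr.
Qed.

Lemma tensor_pairing_linear (x : bar A) :
  linear (fun u : tensor X => tensor_pairing u x : k^o).
Proof. exact/tlift_linear/multilinear_tlift/pairing_multilinear. Qed.

Lemma tensor_pairing_pure fs x :
  tensor_pairing (tpure fs) (length_proj (size fs) x) =
  (-1) ^+ 'C(size fs, 2) * eval_tensor fs x.
Proof.
have hw : @multilinear k (aug A) k^o (fun w => if size fs == size w then
    (-1) ^+ 'C(size w, 2) * \prod_(fw <- zip fs w) fw.1 (tpure [:: fw.2])
    else 0).
  move=> u v c a b; rewrite !signed_eval_wordE eval_word_multilinear.
  by rewrite mulrDr scalerAr.
rewrite /tensor_pairing /length_proj tlift_pure; last first.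
  exact/multilinear_tlift/pairing_multilinear.
move: x; apply: (@linear_ext_tensor k _ k^o) => [c x y|c x y|w].
- by rewrite (tlift_linear (length_proj_multilinear _)) (tlift_linear hw).
- by rewrite eval_tensor_linear mulrDr scalerAr.
rewrite tlift_pure; last exact: length_proj_multilinear.
rewrite eval_tensor_pure eval_wordE eq_sym.
case: eqP => e; last by rewrite (tlift0 hw) mulr0.
by rewrite tlift_pure // e eqxx.
Qed.

End Cochains.

(** * The embedding of the algebra into the tensor algebra of its generators *)

Section Generators.
Set Implicit Arguments. Unset Strict Implicit.
Variables (k : fieldType) (A : cgAlgebra k).
Variables (Q : nat -> set (aug A)) (hQ : generating_space Q).
Variables (xi : nat -> aug A -> bar A) (hxi : splitting Q xi).
Variables (theta : {linear aug A -> bar A}) (htheta : theta_embedding Q xi theta).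

Lemma decomposables0 s : decomposables Q s 0.
Proof.
exists 0; first by case: (span_subspace [set x | exists i q a,
  [/\ (0 < i < s)%N, Q i q, aug_gr (s - i) a & x = tpure [:: q; a]]]).
exact: linear_at0 (@bar_mult_linear _ A).
Qed.

Lemma QA_linear_ext (M : lmodType k) (f g : bar A -> M) s : linear f -> linear g ->
  (forall i q a, (0 < i < s)%N -> Q i q -> aug_gr (s - i) a ->
     f (tpure [:: q; a]) = g (tpure [:: q; a])) ->
  forall x, QA Q s x -> f x = g x.
Proof.
move=> fL gL fg; apply: span_ind => [|x [i [q [a [hi Qq ha ->]]]]]; last first.
  exact: fg hi Qq ha.
split=> [|c x y /= hx hy]; first by rewrite /= (linear_at0 fL) (linear_at0 gL).
by rewrite fL gL hx hy.
Qed.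

Lemma generator_gr s q : (0 < s)%N -> Q s q -> aug_gr s q.
Proof.
move=> s0 Qq; have [_ [-> _]] := hQ s0.
exists 0; first exact: decomposables0.
by exists q; rewrite ?add0r.
Qed.

(** In Adams degree 1 everything is a generator, which is why the decomposable
    part vanishes there; theta is prescribed on decomposables only for s > 1. *)
Lemma aug_gr_cases s a : (0 < s)%N -> aug_gr s a ->
  exists d q, [/\ a = d + q, decomposables Q s d, Q s q & s = 1%N -> d = 0].
Proof.
move=> s0; have [_ [-> _]] := hQ s0 => -[d Dd [q Qq <-]].
exists d, q; split=> // s1; case: Dd => x hx e.
apply: val_inj; apply: (etrans (esym e)).
suff -> : x = 0.
  exact: linear_at0 (@bar_mult_linear _ A).
move: x hx {e}; apply: span_ind => [|x].
  by split=> // c x y -> ->; rewrite scaler0 addr0.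
by move=> [i [q' [a' [/andP[h1 h2]]]]]; move: h2; rewrite s1 ltnS leqNgt h1.
Qed.

Lemma id_tensor_multilinear : @multilinear k (aug A) (bar A)
  (fun w => if w is [:: q; a] then tpure [:: q] * theta a else 0).
Proof.
move=> u v c x y.
case: u => [|a [|b [|d u]]] /=; rewrite ?scaler0 ?addr0 //.
- case: v => [|b [|d v]]; rewrite ?scaler0 ?addr0 //.
  by rewrite (tpure_multilinear [::]) mulrDl scalerAl.
- case: v => [|b v]; rewrite ?scaler0 ?addr0 //.
  by rewrite linearP mulrDr scalerAr.
Qed.

Lemma id_tensor_linear : linear (id_tensor theta).
Proof. exact: tlift_linear id_tensor_multilinear. Qed.

Lemma id_tensor_pure q a : id_tensor theta (tpure [:: q; a]) = tpure [:: q] * theta a.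
Proof. exact: tlift_pure id_tensor_multilinear _. Qed.

Lemma bar_mult_id_tensor s x :
  (forall t a, (0 < t < s)%N -> aug_gr t a -> bar_mult (theta a) = aug_val a) ->
  QA Q s x -> bar_mult (id_tensor theta x) = bar_mult x.
Proof.
move=> IH; move: x; apply: span_ind.
  split=> [|c x y /= hx hy]; last by rewrite id_tensor_linear !bar_mult_linear hx hy.
  by rewrite (linear_at0 id_tensor_linear).
move=> y [i [q [a [/andP[i0 is_] Qq ha ->]]]] /=.
rewrite id_tensor_pure bar_multM (IH (s - i)%N) //.
  by rewrite !bar_mult_pure !big_cons !big_nil !mulr1.
by rewrite subn_gt0 is_ ltn_subrL i0 (ltn_trans i0).
Qed.

(** Induction on the Adams degree: on a decomposable d, theta is
    (id (x) theta) o xi, where theta is only applied to elements of smaller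
    degree, and xi itself splits the multiplication. *)
Lemma theta_splits s a : (0 < s)%N -> aug_gr s a -> bar_mult (theta a) = aug_val a.
Proof.
elim/ltn_ind: s a => s IH a s0 /(aug_gr_cases s0)[d [q [-> Dd Qq d0]]].
have [tQ tD] := htheta.
rewrite linearD (tQ _ _ s0 Qq) -[theta d]scale1r bar_mult_linear scale1r.
rewrite bar_mult_pure big_seq1; congr (_ + _).
case: (ltnP 1 s) => s1; last first.
  rewrite d0 ?linear0; last by apply/eqP; rewrite eqn_leq s1.
  exact: linear_at0 (@bar_mult_linear _ A).
have [_ /(_ _ Dd) hx /(_ _ Dd) e] := hxi s1.
rewrite (tD _ _ s1 Dd) (bar_mult_id_tensor _ hx) ?e //.
by move=> t b /andP[t0 ts]; apply: IH.
Qed.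

Lemma bar_mult_id_tensor_theta s x : QA Q s x ->
  bar_mult (id_tensor theta x) = bar_mult x.
Proof. by apply: bar_mult_id_tensor => t a /andP[t0 _]; apply: theta_splits. Qed.

(** Multiplication of r in A and of its image (id (x) theta)(r) in the tensor
    algebra on Q give the same element, and the latter is a relation. *)
Lemma relation_bar_mult (R : nat -> set (bar A)) s r :
  generates_relations Q (fun s => id_tensor theta @` R s) ->
  QA Q s r -> R s r -> bar_mult r = 0.
Proof.
move=> [_ e] hr Rr; rewrite -(bar_mult_id_tensor_theta hr).
have T1 : TQ Q (1 : bar A).
  by apply: Defs.sub_span; exists 0%N, 0%N, [::]; split=> //; apply: hword_nil.
have : TQ_ideal Q (fun s => id_tensor theta @` R s) (id_tensor theta r).
  apply: Defs.sub_span; exists s, 1, (id_tensor theta r), 1.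
  by split; rewrite ?mul1r ?mulr1 //; exists r.
by rewrite e => -[].
Qed.

(** The differential of the bar construction sends [q|a] to - [qa], so a
    coboundary only sees the product of the entries. *)
Lemma bar_diff_QA (f : bar_dual A) s x d : QA Q s x -> bar_mult x = aug_val d ->
  bar_diff f x = - f (tpure [:: d]).
Proof.
have tp1 c (y z : aug A) : tpure [:: c *: y + z] = c *: tpure [:: y] + tpure [:: z].
  exact: (tpure_multilinear [::]).
move=> hx e; suff [b -> eb] :
    exists2 b, bar_diff f x = - f (tpure [:: b]) & bar_mult x = aug_val b.
  by rewrite (_ : d = b) //; apply/val_inj/(etrans (esym e)).
move: x hx {e}; apply: span_ind.
  split=> [|c x y [a fx bx] [b fy byy]].
    exists 0.
      by rewrite (linear_at0 tp1) !linear0.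
    exact: linear_at0 (@bar_mult_linear _ A).
  exists (c *: a + b); last by rewrite bar_mult_linear bx byy.
  by rewrite bar_dual_linear fx fy tp1 bar_dual_linear scalerN opprD.
move=> y [i [q [a [_ _ _ ->]]]]; exists (aug_mul q a).
  exact: bar_diff_pair.
by rewrite bar_mult_pure !big_cons big_nil mulr1.
Qed.

End Generators.

(** * Higher products of degree 1 classes *)

Section HigherProducts.
Set Implicit Arguments. Unset Strict Implicit.
Variables (k : fieldType) (A : cgAlgebra k).
Local Notation X := (bar_dual A).
Local Notation comp := (@bar_dual_comp k A).
Local Notation sg := (@bar_dual_sign k A).
Variables (Q : nat -> set (aug A)) (hQ : generating_space Q).
Variables (xi : nat -> aug A -> bar A) (hxi : splitting Q xi).
Variables (theta : {linear aug A -> bar A}) (htheta : theta_embedding Q xi theta).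
Variables (R : nat -> set (bar A)).
Variables (H L : int -> int -> set X) (G p : {linear X -> X}).
Hypothesis hM : merkulov_data comp (@bar_diff k A) H L G p.
Hypothesis hR : forall s, R s `<=` QA Q s.
Hypothesis hR0 : forall s r, R s r -> bar_mult r = 0.
Hypothesis hH1 : forall s : nat, H 1 (- s%:Z) =
  bar_ann 1 (- s%:Z) [set tpure [:: a] | a in decomposables Q s].
Hypothesis hL1 : forall s : nat, L 1 (- s%:Z) =
  bar_ann 1 (- s%:Z) [set tpure [:: a] | a in Q s].
Hypothesis hH2 : forall s : nat, H 2 (- s%:Z) = bar_ann 2 (- s%:Z)
  (@bar_d k A @` tpow (@aug_gr k A) 3 s `|` xi s @` decomposables Q s).
Hypothesis hL2 : forall s : nat, L 2 (- s%:Z) =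
  bar_ann 2 (- s%:Z) (R s `|` xi s @` decomposables Q s).

Local Notation H1 := (fun i : nat => H 1 (- i%:Z)).
Local Notation lambda := (lambda_rec sg G).
Local Notation Glam := (Glambda sg G).

(** G takes its values in L; the convention g_1 = - id is the only
    exception. *)
Lemma Glambda_L1 N s xs : size xs != 1%N -> comp 2 (- s%:Z) (lambda N xs) ->
  L 1 (- s%:Z) (Glam N xs).
Proof.
move=> h1 /(merkulov_decomposition hM)[y [h [l [Ly _ _ _ [Gx _]]]]].
by case: xs Gx h1 => [|x [|x' xs]] //= ->.
Qed.

(** The signs inserted by Merkulov's recursion do not leave H^1. *)
Lemma H1_iter_sign e n s xs : hword H1 n s xs ->
  hword H1 n s (map (iter e sg) xs).
Proof.
apply: hword_map => i f; elim: e => //= e IH /IH.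
rewrite hH1 => -[hc hD]; split=> [m t w hw hne|_ [a Da <-]].
  by rewrite bar_dual_signE (hc m t) ?mulr0.
by rewrite bar_dual_signE hD ?mulr0 //; exists a.
Qed.

Lemma H1_comp s f : H 1 (- s%:Z) f -> comp 1 (- s%:Z) f.
Proof. by rewrite hH1 => -[]. Qed.

Lemma L1_comp s f : L 1 (- s%:Z) f -> comp 1 (- s%:Z) f.
Proof. by rewrite hL1 => -[]. Qed.

(** For i = s this is the choice of L^1, and for i <> s it holds for degree
    reasons. *)
Lemma L1_generator s f i q : L 1 (- s%:Z) f -> (0 < i)%N -> Q i q ->
  f (tpure [:: q]) = 0.
Proof.
move=> Lf i0 Qq; have [is_|ne] := eqVneq i s.
  by move: Lf; rewrite hL1 -is_ => -[_]; apply; exists q.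
apply: bar_dual_comp1 (L1_comp Lf) i0 (generator_gr hQ i0 Qq) _.
by rewrite eqr_opp eqz_nat eq_sym.
Qed.

Lemma Glambda_comp N n s xs : hword H1 n s xs ->
  comp 2 (- s%:Z) (lambda N xs) -> comp 1 (- s%:Z) (Glam N xs).
Proof.
move=> hxs hl; have [e|/Glambda_L1 /(_ hl)] := eqVneq (size xs) 1%N.
  case: xs e hxs {hl} => [|f [|g xs]] // _ /hword_consE[n' [i [s' [_ -> _ Hf]]]].
  case/hword_nilE => _ ->; rewrite addn0 /= -scaleN1r.
  by apply: subspaceZ (H1_comp Hf); apply: bar_dual_comp_subspace.
exact: L1_comp.
Qed.

Lemma lambda_comp N n s xs : hword H1 n s xs -> comp 2 (- s%:Z) (lambda N xs).
Proof.
elim: N n s xs => [|N IH] n s xs hxs;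
  have [c0 cL] := bar_dual_comp_subspace A 2 (- s%:Z) => //.
rewrite lambda_recE; last exact: bar_dual_signK.
apply: big_ind => // [x y hx hy|j _].
  by rewrite -[x]scale1r; apply: cL.
have [n1 [s1 [n2 [s2 [h1 h2 _ es]]]]] := hword_split j hxs.
rewrite sign_mulrE -es PoszD opprD -[2]/(1 + 1).
apply: subspaceZ (bar_dual_comp_subspace _ _ _) _.
apply: bar_dual_compM.
  have h1' := H1_iter_sign (size xs - j).+1 h1.
  exact: Glambda_comp h1' (IH _ _ _ h1').
exact: Glambda_comp h2 (IH _ _ _ h2).
Qed.

(** In the term of index j > 1 the first factor is g_j applied to f and some
    further arguments; it lies in L^1 and is killed by the generator q.  Only
    j = 1 remains, where g_1 = - id and sg has been applied to f as many times
    as there are arguments. *)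
Lemma lambda_pair N n s f xs i q a : hword H1 n s (f :: xs) ->
  (0 < size xs)%N -> (0 < i)%N -> Q i q ->
  lambda N.+1 (f :: xs) (tpure [:: q; a]) =
  (-1) ^+ (size xs).+1 * (f (tpure [:: q]) * Glam N xs (tpure [:: a])).
Proof.
move=> hxs xs0 i0 Qq; rewrite lambda_recE; last exact: bar_dual_signK.
have termE j : ((-1) ^+ j.+1 *
    (Glam N (map (iter (size (f :: xs) - j).+1 sg) (take j (f :: xs))) *
     Glam N (drop j (f :: xs)))) (tpure [:: q; a]) =
    (-1) ^+ j *
    (Glam N (map (iter (size (f :: xs) - j).+1 sg) (take j (f :: xs)))
       (tpure [:: q]) *
     Glam N (drop j (f :: xs)) (tpure [:: a])).
  have [n1 [s1 [n2 [s2 [h1 h2 _ _]]]]] := hword_split j hxs.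
  have h1' := H1_iter_sign (size (f :: xs) - j).+1 h1.
  rewrite sign_mulrE bar_dualZE (@bar_dualM_pair _ _ (- s1%:Z) (- s2%:Z)).
  - by rewrite exprS mulN1r mulrNN.
  - exact: Glambda_comp h1' (lambda_comp _ h1').
  - exact: Glambda_comp h2 (lambda_comp _ h2).
rewrite bar_dual_sumE (eq_bigr _ (fun j _ => termE j)) big_ltn //.
rewrite big_nat_cond big1 => [|j]; last first.
  rewrite andbT => /andP[j1 jn].
  have [n1 [s1 [n2 [s2 [h1 h2 _ _]]]]] := hword_split j hxs.
  have h1' := H1_iter_sign (size (f :: xs) - j).+1 h1.
  have ne1 :
      size (map (iter (size (f :: xs) - j).+1 sg) (take j (f :: xs))) != 1%N.
    by rewrite size_map size_takel 1?ltnW // neq_ltn j1 orbT.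
  have Lg := Glambda_L1 ne1 (lambda_comp N h1').
  by rewrite (L1_generator Lg i0 Qq) mul0r mulr0.
(* In the surviving term, j = 1, the sign of g_1 = - id cancels (-1) ^+ j. *)
rewrite addr0 /= subSS subn0 drop0 take0 /= expr1 mulN1r.
rewrite [X in X * _](_ : _ = - (iter (size xs).+1 sg f (tpure [:: q]))) //.
by rewrite iter_bar_dual_signE mulNr opprK mulrA.
Qed.

(** Every word occurring in theta(a) has positive length. *)
Lemma eval_theta_nil t a : (0 < t)%N -> aug_gr t a ->
  eval_tensor [::] (theta a) = 0.
Proof.
move=> t0 /(aug_gr_cases hQ t0)[d [q [-> Dd Qq d0]]].
have [tQ tD] := htheta; have eL := @eval_tensor_linear k A [::].
rewrite linearD -[theta d]scale1r eL (tQ _ _ t0 Qq) eval_tensor_pure.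
rewrite addr0 scale1r.
case: (ltnP 1 t) => t1; last first.
  by rewrite d0 ?linear0 ?(linear_at0 eL) //; apply/eqP; rewrite eqn_leq t1.
have [_ /(_ _ Dd) hx _] := hxi t1; rewrite (tD _ _ t1 Dd).
apply: (@QA_linear_ext _ _ Q k^o (fun x => eval_tensor [::] (id_tensor theta x))
  (fun=> 0) t _ _ _ _ hx) => [c x y|c x y|i b c _ _ _].
- by rewrite id_tensor_linear eL.
- by rewrite scaler0 addr0.
- by rewrite id_tensor_pure eval_tensor_nil.
Qed.

(** Every word occurring in theta(d) has length at least 2 when d is
    decomposable. *)
Lemma eval_theta_decomposable1 f s d : (1 < s)%N -> decomposables Q s d ->
  eval_tensor [:: f] (theta d) = 0.
Proof.
move=> s1 Dd; have [_ tD] := htheta; rewrite (tD _ _ s1 Dd).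
have [_ /(_ _ Dd) hx _] := hxi s1.
apply: (@QA_linear_ext _ _ Q k^o (fun x => eval_tensor [:: f] (id_tensor theta x))
  (fun=> 0) s _ _ _ _ hx) => [c x y|c x y|i q a].
- by rewrite id_tensor_linear eval_tensor_linear.
- by rewrite scaler0 addr0.
move=> /andP[_ is_] _ ha; rewrite id_tensor_pure eval_tensor_cons.
by rewrite (eval_theta_nil _ ha) ?mulr0 ?subn_gt0.
Qed.

(** The induction hypothesis on the recursion depth N.  A single argument needs
    no depth at all, since g_1 = - id; this is the reason for maxn 1 N. *)
Definition Glambda_is_eval N := forall n s xs a, (0 < n <= maxn 1 N)%N ->
  hword H1 n s xs -> aug_gr s a -> Glam N xs (tpure [:: a]) =
    - ((-1) ^+ 'C(n, 2) * eval_tensor xs (theta a)).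

(** On [q|a] this is [lambda_pair] followed by the induction hypothesis for a;
    the signs match because 'C(n + 1, 2) = 'C(n, 2) + n.  If q and the first
    argument have different Adams degrees, both sides vanish. *)
Lemma lambda_QA N n s xs x : Glambda_is_eval N -> (1 < n <= N.+1)%N ->
  hword H1 n s xs -> QA Q s x -> lambda N.+1 xs x =
    (-1) ^+ 'C(n, 2) * eval_tensor xs (id_tensor theta x).
Proof.
move=> IH hn hxs hx.
apply: (@QA_linear_ext _ _ Q k^o (lambda N.+1 xs) (fun x =>
  (-1) ^+ 'C(n, 2) * eval_tensor xs (id_tensor theta x)) s _ _ _ _ hx).
- exact: bar_dual_linear.
- by move=> c y z; rewrite id_tensor_linear eval_tensor_linear mulrDr scalerAr.
move=> i q a /andP[i0 is_] Qq ha; rewrite id_tensor_pure.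
case: xs hxs hn => [/hword_nilE[-> _]//|f xs] hxs hn.
have [n' [i' [s' [en es i'0 hf hxs']]]] := hword_consE hxs.
have size_xs := hword_size hxs'; subst n.
rewrite (lambda_pair N a hxs _ i0 Qq) size_xs; last by case/andP: hn.
rewrite eval_tensor_cons; have [ei|ne] := eqVneq i' i; last first.
  rewrite (bar_dual_comp1 (H1_comp hf) i0 (generator_gr hQ i0 Qq)).
    by rewrite !(mul0r, mulr0).
  by rewrite eqr_opp eqz_nat.
rewrite (IH n' s' xs a) //; last by move: ha; rewrite es ei addKn.
  rewrite binS bin1 exprD exprS mulN1r mulrN mulrNN.
  by rewrite (mulrC ((-1) ^+ 'C(n', 2))) -[RHS]mulrA [RHS]mulrC !mulrA.
case/andP: hn => h1 h2; apply/andP; split => //.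
by rewrite leq_max -[(n' <= N)%N]ltnS h2 orbT.
Qed.

Lemma bar_diff_R f s r : R s r -> bar_diff f r = 0.
Proof.
move=> Rr; rewrite (@bar_diff_QA _ _ Q f s r 0 (hR Rr)); last exact: hR0 Rr.
by rewrite (linear_at0 (f := fun a => f (tpure [:: a]))) ?oppr0 // => c x y;
   exact: (bar_dual_multilinear f [::]).
Qed.

(** Evaluate lambda = del y + h + l, with y = G lambda, on xi(d): h and l vanish
    there, and del y gives - y(d) because xi(d) multiplies to d. *)
Lemma Glambda_decomposable N s xs d : size xs != 1%N ->
  comp 2 (- s%:Z) (lambda N xs) -> (1 < s)%N -> decomposables Q s d ->
  Glam N xs (tpure [:: d]) = - lambda N xs (xi s d).
Proof.
move=> ne1 hl s1 Dd; have [_ /(_ _ Dd) hx /(_ _ Dd) e] := hxi s1.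
have -> : Glam N xs = G (lambda N xs) by case: xs ne1 {hl} => [|f [|g xs]].
have [y [h [l [Ly Hh Ll -> [-> _]]]]] := merkulov_decomposition hM hl.
rewrite !bar_dualDE (bar_diff_QA _ hx e).
move: Hh Ll; rewrite hH2 hL2 => -[_ ->]; last by right; exists d.
by move=> [_ ->]; [rewrite !addr0 opprK|right; exists d].
Qed.

Lemma eval_theta_generator xs i q : size xs != 1%N -> (0 < i)%N -> Q i q ->
  eval_tensor xs (theta q) = 0.
Proof.
have [tQ _] := htheta => ne1 i0 Qq.
by rewrite (tQ _ _ i0 Qq) eval_tensor_pure eval_wordE (negbTE ne1).
Qed.

(** A class in H^1 vanishes on decomposables, as does the length 1 part of
    theta. *)
Lemma eval_theta1 f s a : (0 < s)%N -> H 1 (- s%:Z) f -> aug_gr s a ->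
  eval_tensor [:: f] (theta a) = f (tpure [:: a]).
Proof.
move=> s0 Hf /(aug_gr_cases hQ s0)[d [q [-> Dd Qq d0]]].
have fL : linear (fun a => f (tpure [:: a])) := bar_dual_multilinear f [::] [::].
have [tQ tD] := htheta.
rewrite linearD -[theta d]scale1r -[d in RHS]scale1r eval_tensor_linear fL.
rewrite (tQ _ _ s0 Qq) eval_tensor_pure /= mulr1; congr (_ *: _ + _).
move: (Hf); rewrite hH1 => -[_ ->]; last by exists d.
case: (ltnP 1 s) => s1; first exact: eval_theta_decomposable1 s1 Dd.
rewrite d0 ?linear0 ?(linear_at0 (eval_tensor_linear _)) //.
by apply/eqP; rewrite eqn_leq s1.
Qed.

Lemma Glambda_theta1 N n s xs a : n = 1%N -> hword H1 n s xs -> aug_gr s a ->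
  Glam N xs (tpure [:: a]) = - ((-1) ^+ 'C(n, 2) * eval_tensor xs (theta a)).
Proof.
move=> -> {n}; case: xs => [|f [|g xs]] hxs; have := hword_size hxs => // _.
have [_ [i [s' [_ es s0 Hf /hword_nilE[_ s'0]]]]] := hword_consE hxs.
move: es; rewrite s'0 addn0 => -> ha.
by rewrite (eval_theta1 s0 Hf ha) mul1r.
Qed.

(** On generators both sides vanish for n > 1, since g_n lies in L^1 and
    theta(q) = [q] has length 1; on decomposables the formula for g_n follows
    from the one for lambda_n on xi(d). *)
Lemma Glambda_theta N : Glambda_is_eval N.
Proof.
elim: N => [|N IH] n s xs a hn hxs ha; have [n1|ne1] := eqVneq n 1%N.
- exact: Glambda_theta1 n1 hxs ha.
- by case: n hn ne1 hxs => [|[|n]].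
- exact: Glambda_theta1 n1 hxs ha.
have s0 : (0 < s)%N.
  case: xs hxs => [/hword_nilE[n0]|f xs /hword_consE[? [i [s' [_ -> i0 _ _]]]]].
    by rewrite n0 in hn.
  by rewrite addn_gt0 i0.
have size_xs := hword_size hxs; have sne1 : size xs != 1%N by rewrite size_xs.
have hl := lambda_comp N.+1 hxs.
have [d [q [-> Dd Qq d0]]] := aug_gr_cases hQ s0 ha.
have gL := bar_dual_multilinear (Glam N.+1 xs) [::] [::].
rewrite -[d]scale1r gL linearP eval_tensor_linear !scale1r /=.
rewrite (eval_theta_generator sne1 s0 Qq) addr0.
rewrite (L1_generator (Glambda_L1 sne1 hl) s0 Qq) addr0.
case: (ltnP 1 s) => s1; last first.
  have -> : d = 0 by apply: d0; apply/eqP; rewrite eqn_leq s1.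
  rewrite linear0 (linear_at0 (eval_tensor_linear _)) mulr0 oppr0.
  exact: linear_at0 gL.
have [_ tD] := htheta; rewrite (tD _ _ s1 Dd).
rewrite (Glambda_decomposable sne1 hl s1 Dd); congr (- _).
have [_ /(_ _ Dd) hx _] := hxi s1.
apply: lambda_QA IH _ hxs hx.
move: hn; rewrite (maxn_idPr _) // => /andP[n0 ->].
by rewrite ltn_neqAle eq_sym ne1 n0.
Qed.

(** The theorem on pure tensors: lambda_n = del y + h + l with h = m_n, and
    del y and l vanish on R. *)
Lemma higher_product n s xs : (1 < n)%N -> hword H1 n s xs ->
  H 2 (- s%:Z) (merkulov_m sg G p n (tpure xs)) /\
  forall r, R s r -> merkulov_m sg G p n (tpure xs) r =
    tensor_pairing (tpure xs) (length_proj n (id_tensor theta r)).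
Proof.
move=> n1 hxs; have size_xs := hword_size hxs.
rewrite /merkulov_m tlift_pure; last exact/merkulov_m_multilinear/bar_dual_signK.
rewrite n1 size_xs eqxx /= /merkulov_lambda.
have hl := lambda_comp (size xs) hxs.
have [y [h [l [_ Hh Ll e [_ ->]]]]] := merkulov_decomposition hM hl.
split=> // r Rr; transitivity (lambda (size xs) xs r).
  rewrite e !bar_dualDE (bar_diff_R _ Rr) add0r.
  by move: Ll; rewrite hL2 => -[_ ->]; [rewrite addr0|left].
rewrite -size_xs tensor_pairing_pure size_xs.
case: n n1 hxs {size_xs hl e} => // n n1 hxs.
by apply: lambda_QA (Glambda_theta (N:=n)) _ hxs (hR Rr); rewrite n1 leqnn.
Qed.

End HigherProducts.

Theorem theoremA (k : fieldType) (A : cgAlgebra k) (hA : locally_finite A)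
  (* generators Q, the splittings xi and the embeddings theta *)
  (Q : nat -> set (aug A)) (hQ : generating_space Q)
  (xi : nat -> aug A -> bar A) (hxi : splitting Q xi)
  (theta : {linear aug A -> bar A}) (htheta : theta_embedding Q xi theta)
  (* a minimal graded space of relations *)
  (R : nat -> set (bar A)) (hRsub : forall s, subspace (R s))
  (hRQA : forall s, R s `<=` QA Q s)
  (hRmin : minimal_relations Q (fun s => id_tensor theta @` R s))
  (* the Merkulov model of the dual of BA attached to these choices *)
  (H L : int -> int -> set (bar_dual A))
  (G p : {linear bar_dual A -> bar_dual A})
  (hM : merkulov_data (@bar_dual_comp k A) (@bar_diff k A) H L G p)
  (hH1 : forall s : nat, H 1 (- s%:Z) =
    bar_ann 1 (- s%:Z) [set tpure [:: a] | a in decomposables Q s])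
  (hL1 : forall s : nat, L 1 (- s%:Z) =
    bar_ann 1 (- s%:Z) [set tpure [:: a] | a in Q s])
  (hH2 : forall s : nat, H 2 (- s%:Z) =
    bar_ann 2 (- s%:Z)
      (@bar_d k A @` tpow (@aug_gr k A) 3 s `|` xi s @` decomposables Q s))
  (hL2 : forall s : nat, L 2 (- s%:Z) =
    bar_ann 2 (- s%:Z) (R s `|` xi s @` decomposables Q s)) :
  forall n s : nat, (2 <= n)%N -> (2 <= s)%N ->
  forall u : tensor (bar_dual A),
    tpow (fun i : nat => H 1 (- i%:Z)) n s u ->
    H 2 (- s%:Z) (merkulov_m (@bar_dual_sign k A) G p n u) /\
    forall r : bar A, R s r ->
      merkulov_m (@bar_dual_sign k A) G p n u r =
      tensor_pairing u (length_proj n (id_tensor theta r)).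
Proof.
move=> n s n2 _ u hu.
have hR0 t r : R t r -> bar_mult r = 0.
  by move=> Rr; apply: (relation_bar_mult hQ hxi htheta hRmin.1 (hRQA _ _ Rr) Rr).
have mL : linear (merkulov_m (@bar_dual_sign k A) G p n).
  exact/tlift_linear/merkulov_m_multilinear/bar_dual_signK.
move: u hu; apply: span_ind => [|u [xs hxs <-]]; last first.
  exact: (higher_product hQ hxi htheta hM hRQA hR0 hH1 hL1 hH2 hL2 n2 hxs).
have [H0 HL] := merkulov_H hM 2 (- s%:Z); split.
  split=> [|r _]; first by rewrite (linear_at0 mL).
  by rewrite (linear_at0 mL) (linear_at0 (tensor_pairing_linear _)).
move=> c u v [Hu eu] [Hv ev]; split=> [|r Rr]; first by rewrite mL; apply: HL.
by rewrite mL tensor_pairing_linear bar_dualDE bar_dualZE eu ?ev.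
Qed.
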